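(* Let $w\in\mathbb{R}$ with $w>0$ and let $b,z\in\mathbb{C}$ satisfy $\Re(z)>0$ and $\Re(b+1-z)>0$. Then $$\int_{0}^{\infty}v^{z-1}\,\eta\!\left(b+1,\,v+w+\tfrac12\right)dv=\frac{\Gamma(z)\,\Gamma(b+1-z)}{\Gamma(b+1)}\;\eta\!\left(b+1-z,\,w+\tfrac12\right).$$
   Context: $\eta(s,a)$ is the alternating Hurwitz zeta function, $\eta(s,a)=\sum_{k=0}^{\infty}(-1)^k/(k+a)^s$ for $\Re(s)>0$, with $a>0$ here. *)

(* Defs.v *)
From mathcomp Require Import all_boot all_order all_algebra.
From mathcomp Require Import all_classical all_reals all_analysis.
From mathcomp Require Import complex.

Set Implicit Arguments.
Unset Strict Implicit.
Unset Printing Implicit Defensive.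

Import Order.TTheory GRing.Theory Num.Theory.
Import numFieldNormedType.Exports.

Local Open Scope ring_scope.
Local Open Scope complex_scope.
Local Open Scope classical_set_scope.

Definition cexp (R : realType) (z : R[i]) : R[i] :=
  (expR (complex.Re z))%:C * (cos (complex.Im z) +i* sin (complex.Im z)).

(* Principal value of [x ^ s]. Only meaningful for [0 < x]: [ln] is totalized
   on nonpositive reals. *)
Definition cpow (R : realType) (x : R) (s : R[i]) : R[i] :=
  cexp (s * (ln x)%:C).

Definition cintegrable d (T : measurableType d) (R : realType)
    (mu : {measure set T -> \bar R}) (D : set T) (f : T -> R[i]) : Prop :=
  mu.-integrable D (EFin \o (@complex.Re R \o f)) /\
  mu.-integrable D (EFin \o (@complex.Im R \o f)).

Definition cintegral d (T : measurableType d) (R : realType)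
    (mu : {measure set T -> \bar R}) (D : set T) (f : T -> R[i]) : R[i] :=
  Rintegral mu D (@complex.Re R \o f) +i* Rintegral mu D (@complex.Im R \o f).

(* Euler's integral; it is the Gamma function on the half-plane [0 < Re s]. *)
Definition Gamma (R : realType) (s : R[i]) : R[i] :=
  cintegral (@lebesgue_measure R) `]0, +oo[
    (fun t : R => cpow t (s - 1) * (expR (- t))%:C).

(* The series converges only conditionally when [0 < Re s <= 1], so its sum is
   the limit of the partial sums. [R[i]^o] carries the usual topology of the
   complex plane. *)
Definition alt_hurwitz_zeta (R : realType) (s : R[i]) (a : R) : R[i] :=
  limn (series (fun k : nat => (-1) ^+ k / cpow (k%:R + a) s) : nat -> R[i]^o).

(* Main.v *)
(* Write K(t) = 1 / (1 + e^-t) and E(s, a) = int_0^oo t^(s-1) e^(-at) K(t) dt.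
   Since K(t) (1 + e^-t) = 1, E(s, a) + E(s, a + 1) = Gamma(s) a^-s, so the
   partial sums of Gamma(s) eta(s, a) telescope to E(s, a) up to an error
   (-1)^n E(s, a + n) -> 0. Hence Gamma(s) eta(s, a) = E(s, a), and exchanging
   the integrals in t and v gives
     int_0^oo v^(z-1) E(s, v + a) dv = Gamma(z) E(s - z, a).
   To divide by Gamma(s) one needs Gamma(s) <> 0 for Re s > 0: by
   Gamma(s + 1) = s Gamma(s) it is enough to treat p + i tau with p large, where
   Re (p^(-i tau) Gamma(p + i tau)) >= Gamma(p) (1 - 2 tau^2 / (p - 1)) > 0. *)
Require Import Defs.
From mathcomp Require Import all_boot all_order all_algebra.
From mathcomp Require Import all_classical all_reals all_analysis.
From mathcomp Require Import complex.
From mathcomp Require Import measurable_realfun ring lra.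
Import Order.TTheory GRing.Theory Num.Theory.
Import numFieldNormedType.Exports.

Local Open Scope ring_scope.
Local Open Scope complex_scope.
Local Open Scope classical_set_scope.

Set Implicit Arguments.
Unset Strict Implicit.
Unset Printing Implicit Defensive.

(** * Scaling of the Lebesgue measure *)

(** [K(t)] is the sum of the geometric series of (-1)^k e^(-kt), so [E(s, a)] is what termwise
    integration of the eta series would give. That interchange is not absolutely convergent when Re
    s <= 1: the moduli integrate to Gamma(Re s) (k + a)^(-Re s), whose sum diverges. Telescoping
    avoids it, since it only asks for a bound of [E(s, a + n)] by a multiple of (a + n)^(-Re s). The
    exchange of t and v, by contrast, is absolutely convergent: 0 <= K <= 1, and integrating the
    moduli over v leaves Gamma(Re z) t^(Re(s - z) - 1) e^(-at). The hypotheses Re z > 0 and Re(s -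
    z) > 0 make the majorants integrable at v = 0 and at t = 0. The term 2 tau^2 / (p - 1) is a mean
    value: under the Gamma density of parameter p, t/p has mean 1 and p/t has mean p / (p - 1), so
    t/p - 2 + p/t, which controls ln(t/p)^2, has mean 1 / (p - 1). *)

Lemma lebesgue_measureM (R : realType) (c : R) (A : set R) : 0 < c ->
  measurable A ->
  lebesgue_measure A = (c%:E * lebesgue_measure (( *%R c) @^-1` A))%E.
Proof.
move=> c0 mA.
have c0' : (0 <= c)%R by exact: ltW.
pose phi : measurableTypeR R -> measurableTypeR R := *%R c.
have mphi : measurable_fun [set: measurableTypeR R] phi.
  exact: mulrl_measurable.
pose nu := mscale (NngNum c0') (pushforward (@lebesgue_measure R) phi).
rewrite -[RHS]/(nu mphi A).
(* The Lebesgue measure is determined by its values on the intervals []a, b]]. *)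
apply: (@lebesgue_measure_unique R (nu mphi)) => //= _ [[a b]] _ <-.
rewrite /mscale/= /pushforward.
have -> : phi @^-1` `]a, b] = `](a / c)%R, (b / c)%R]%classic.
  apply/seteqP; split => x /=; rewrite /phi !in_itv/=;
    by rewrite ltr_pdivrMr// ler_pdivlMr// mulrC.
rewrite !lebesgue_measure_itv/= !lte_fin ltr_pM2r ?invr_gt0//.
case: ifPn => _; last by rewrite mule0.
by rewrite -!EFinB -EFinM mulrBr !(mulrC c) !divfK ?gt_eqF.
Qed.

(** The substitution amounts to rewriting the measure as a scaled pushforward of itself. Infinite
    values are allowed, so that the identity can be applied to a modulus to transfer
    integrability. *)
Lemma ge0_integral_scale (R : realType) (c : R) (f : R -> \bar R) : 0 < c ->
  measurable_fun (`]0, +oo[ : set R) f -> (forall t, 0 < t -> (0 <= f t)%E) ->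
  (\int[lebesgue_measure]_(t in `]0%R, +oo[) f t =
   c%:E * \int[lebesgue_measure]_(t in `]0%R, +oo[) f (c * t)%R)%E.
Proof.
move=> c0 mf f0; have c0' : (0 <= c)%R by exact: ltW.
pose phi : measurableTypeR R -> measurableTypeR R := *%R c.
have mphi : measurable_fun [set: measurableTypeR R] phi.
  exact: mulrl_measurable.
have phiD : phi @^-1` `]0, +oo[ = `]0, +oo[%classic.
  apply/seteqP; split => x /=; rewrite /phi !in_itv/= !andbT;
    by rewrite pmulr_rgt0.
rewrite (eq_measure_integral
  (mscale (NngNum c0') (pushforward (@lebesgue_measure R) phi))); last first.
  by move=> A mA _; exact: lebesgue_measureM.
rewrite ge0_integral_mscale//=.
  rewrite (ge0_integral_pushforward mphi)//=; last first.
    by move=> y; rewrite inE/= in_itv/= andbT; exact: f0.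
  by rewrite phiD.
by move=> x; rewrite in_itv/= andbT; exact: f0.
Qed.

Lemma integrable_scale (R : realType) (c : R) (f : R -> R) : 0 < c ->
  measurable_fun setT f ->
  lebesgue_measure.-integrable `]0, +oo[ (EFin \o f) ->
  lebesgue_measure.-integrable `]0, +oo[ (EFin \o (fun t => f (c * t))).
Proof.
move=> c0 mf /integrableP[_ foo]; apply/integrableP; split.
  apply/measurable_EFinP/measurable_funTS; apply: (measurableT_comp mf).
  exact: mulrl_measurable.
move: foo; rewrite (ge0_integral_scale c0)//; last first.
  by apply: measurableT_comp => //; apply/measurable_EFinP/measurable_funTS.
rewrite -lte_pdivlMl// => /lt_le_trans; apply.
by rewrite muleC gt0_mulye// lte_fin invr_gt0.
Qed.

(** The nonnegative case applies to the positive and the negative part of [f]. *)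
Lemma Rintegral_scale (R : realType) (c : R) (f : R -> R) : 0 < c ->
  measurable_fun setT f ->
  lebesgue_measure.-integrable `]0, +oo[ (EFin \o f) ->
  \int[lebesgue_measure]_(t in `]0, +oo[) f (c * t) =
  c^-1 * \int[lebesgue_measure]_(t in `]0, +oo[) f t.
Proof.
move=> c0 mf fi; apply: (mulfI (lt0r_neq0 c0)); rewrite mulVKf ?gt_eqF//.
have fci := integrable_scale c0 mf fi.
have fpc (g : R -> R) : measurable_fun setT g -> (forall t, 0 <= g t)%R ->
  lebesgue_measure.-integrable `]0, +oo[ (EFin \o g) ->
  c * \int[lebesgue_measure]_(t in `]0, +oo[) g (c * t) =
  \int[lebesgue_measure]_(t in `]0, +oo[) g t.
  move=> mg g0 ig; rewrite /Rintegral.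
  rewrite [in RHS](ge0_integral_scale c0)//; last 2 first.
  - exact/measurable_EFinP/measurable_funTS.
  - by move=> t _; rewrite lee_fin.
  by rewrite fineM// integrable_fin_num//; exact: (integrable_scale c0).
have fE : f = (fun x => f^\+ x - f^\- x).
  by rewrite -[LHS]funrposBneg.
have ip : lebesgue_measure.-integrable `]0, +oo[ (EFin \o f^\+).
  exact: integrable_funrpos.
have im : lebesgue_measure.-integrable `]0, +oo[ (EFin \o f^\-).
  exact: integrable_funrneg.
have mp : measurable_fun setT f^\+ by exact: measurable_funrpos.
have mm : measurable_fun setT f^\- by exact: measurable_funrneg.
rewrite fE RintegralB//; last 2 first.
  exact: (integrable_scale c0 mp).
  exact: (integrable_scale c0 mm).
by rewrite mulrBr !fpc// RintegralB.
Qed.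

(** * The fundamental theorem of calculus on the half-line *)

(** A compact exhaustion that stays away from 0, where integrands may blow up. The shift [n.+1]
    keeps the left endpoint positive and never beyond the right one. *)
Lemma bigcup_itv0y (R : realType) :
  \bigcup_n `[n.+1%:R^-1, n.+1%:R] = `]0, +oo[ :> set R.
Proof.
apply/seteqP; split => x /=.
  move=> [n _]/=; rewrite !in_itv/= andbT => /andP[+ _]; apply: lt_le_trans.
  by rewrite invr_gt0.
rewrite in_itv/= andbT => x0.
exists (maxn (Num.Def.trunc x) (Num.Def.trunc x^-1)) => //=.
rewrite in_itv/=; apply/andP; split.
  rewrite invf_ple ?posrE//; apply: (le_trans (ltW (truncnS_gt x^-1))).
  by rewrite ler_nat ltnS leq_maxr.
apply: (le_trans (ltW (truncnS_gt x))).
by rewrite ler_nat ltnS leq_maxl.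
Qed.

Lemma nondecreasing_itv0y (R : realType) :
  nondecreasing_seq (fun n => `[n.+1%:R^-1, n.+1%:R] : set R).
Proof.
move=> m n mn; rewrite subsetEset => x /=; rewrite !in_itv/= => /andP[mx xm].
apply/andP; split.
  by apply: le_trans mx; rewrite lef_pV2 ?posrE// ler_nat.
by apply: (le_trans xm); rewrite ler_nat.
Qed.

Lemma sub_itv0y (R : realType) n :
  `[n.+1%:R^-1, n.+1%:R] `<=` (`]0, +oo[ : set R).
Proof. by move=> x nx; rewrite -bigcup_itv0y; exists n. Qed.

Section FTC.
Context (R : realType).
Variables f F : R -> R.
Hypothesis dF : forall x : R, 0 < x -> is_derive x 1 F (f x).
Hypothesis cf : forall x : R, 0 < x -> {for x, continuous f}.

Lemma gt0_continuous_measurable : measurable_fun (`]0, +oo[ : set R) f.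
Proof.
apply: open_continuous_measurable_fun; first exact: interval_open.
by move=> x; rewrite inE/= in_itv/= andbT; exact: cf.
Qed.

Lemma gt0_FTC (a b : R) : 0 < a -> a <= b ->
  (\int[lebesgue_measure]_(x in `[a, b]) (f x)%:E = (F b - F a)%:E)%E.
Proof.
move=> a0; rewrite le_eqVlt => /predU1P[<-|ab].
  by rewrite set_itv1 integral_set1 subrr.
have cF (x : R) : 0 < x -> {for x, continuous F}.
  move=> x0; apply: differentiable_continuous; apply/derivable1_diffP.
  by case: (dF x0).
rewrite EFinB; apply: continuous_FTC2 => //.
- apply: continuous_in_subspaceT => x; rewrite inE/= in_itv/= => /andP[ax _].
  by apply: cf; exact: lt_le_trans ax.
- split.
  + move=> x; rewrite in_itv/= => /andP[ax _].
    by case: (dF (lt_trans a0 ax)).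
  + by apply: cvg_at_right_filter; exact: cF.
  + by apply: cvg_at_left_filter; apply: cF; exact: lt_trans ab.
- move=> x; rewrite in_itv/= => /andP[ax _].
  by rewrite derive1E; case: (dF (lt_trans a0 ax)).
Qed.

(** Monotone convergence along the exhaustion: on each compact piece the integral is a difference of
    two values of [F] in [0, M], hence at most [M]. *)
Lemma ge0_integrable_FTC0y (M : R) : (forall x : R, 0 < x -> 0 <= f x) ->
  (forall x : R, 0 < x -> 0 <= F x <= M) ->
  lebesgue_measure.-integrable `]0, +oo[ (EFin \o f).
Proof.
move=> f0 FM; apply/integrableP; split.
  by apply/measurable_EFinP; exact: gt0_continuous_measurable.
apply: (@le_lt_trans _ _ M%:E); last exact: ltry.
have -> : (\int[lebesgue_measure]_(x in `]0%R, +oo[) `|(EFin \o f) x| =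
    \int[lebesgue_measure]_(x in `]0%R, +oo[) (EFin \o f) x)%E.
  apply: eq_integral.
  by move=> x; rewrite inE/= in_itv/= andbT => x0 /=; rewrite ger0_norm ?f0.
rewrite -bigcup_itv0y.
have mf n : measurable_fun (`[n.+1%:R^-1, n.+1%:R] : set R) (EFin \o f).
  apply/measurable_EFinP; apply: measurable_funS gt0_continuous_measurable => //.
  exact: sub_itv0y.
have gt0 n x : (`[n.+1%:R^-1, n.+1%:R] : set R) x -> 0 < x.
  rewrite /= in_itv/= => /andP[+ _]; apply: lt_le_trans.
  by rewrite invr_gt0.
have := @ge0_nondecreasing_set_cvg_integral _ (measurableTypeR R) R _ (EFin \o f)
  (@lebesgue_measure R) (@nondecreasing_itv0y R) (fun=> measurable_itv _) mf.
move=> cvgf.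
have /cvgf cvgf' : forall i x,
    (`[i.+1%:R^-1, i.+1%:R] : set R) x -> (0 <= (EFin \o f) x)%E.
  by move=> i x /gt0 x0; rewrite lee_fin f0.
apply: (cvge_le _ cvgf').
near=> n.
rewrite gt0_FTC//; last by rewrite (@le_trans _ _ 1)// ?invf_le1// ler1n.
have /FM/andP[_ FM1] : 0 < n.+1%:R :> R by [].
have /FM/andP[F0 _] : 0 < n.+1%:R^-1 :> R by rewrite invr_gt0.
by rewrite lee_fin lerBlDr (le_trans FM1)// lerDl.
Unshelve. all: by end_near. Qed.

(** Dominated convergence for the truncations of [f] to the compact pieces, with the modulus of [f]
    as majorant; limits of [F] are thus needed only along the two sequences of endpoints. *)
Lemma Rintegral_FTC0y (A B : R) :
  lebesgue_measure.-integrable `]0, +oo[ (EFin \o f) ->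
  F n.+1%:R^-1 @[n --> \oo] --> A -> F n.+1%:R @[n --> \oo] --> B ->
  \int[lebesgue_measure]_(x in `]0, +oo[) f x = B - A.
Proof.
move=> fi FA FB.
pose J n : set R := `[n.+1%:R^-1, n.+1%:R]%classic.
have JE n : (\int[lebesgue_measure]_(x in `]0%R, +oo[)
    (((EFin \o f) \_ (J n)) x) = (F n.+1%:R - F n.+1%:R^-1)%:E)%E.
  rewrite -integral_mkcondr/=.
  have -> : (`]0, +oo[ `&` J n)%classic = J n.
    by apply/setIidPr; exact: sub_itv0y.
  by rewrite gt0_FTC//; rewrite (@le_trans _ _ 1)// ?invf_le1// ler1n.
have mf : measurable_fun (`]0, +oo[ : set R) (EFin \o f).
  exact: measurable_int fi.
have [//|||||_ _] := @dominated_convergence _ (measurableTypeR R) R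
  (@lebesgue_measure R) (`]0, +oo[)%classic (measurable_itv _)
  (fun n => (EFin \o f) \_ (J n)) (EFin \o f) (abse \o (EFin \o f)).
- move=> n; apply/(measurable_restrict _ _ _) => //; first exact: measurable_itv.
  by apply: measurable_funS mf => //; exact: subIsetl.
- by [].
- apply: aeW => x /= x0; apply: cvg_near_cst.
  have : (\bigcup_n J n) x by rewrite bigcup_itv0y.
  move=> [k _ Jk]; exists k => // n /= kn.
  rewrite patchE mem_set//.
  by have /subsetPset := @nondecreasing_itv0y R _ _ kn; exact.
- exact: integrable_abse.
- apply: aeW => x n _; rewrite patchE; case: ifPn => _; rewrite ?lexx//=.
  by rewrite normr0 lee_fin.
rewrite (_ : [sequence _]_n =
    EFin \o (fun n => F n.+1%:R - F n.+1%:R^-1)); last first.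
  by apply/funext => n /=; exact: JE.
move=> cv.
rewrite /Rintegral; apply/EFin_inj; rewrite fineK ?integrable_fin_num//.
apply: (cvg_unique _ cv) => //.
by apply: cvg_EFin; [exact: nearW|exact: cvgB].
Qed.

End FTC.

(** * Complex powers and complex-valued integrals *)

Section normc.
Context (R : realType).
Implicit Types z : R[i].
Local Notation normc := (@ComplexField.Normc.normc R).

(** [normc] is the modulus as an element of [R], directly comparable with real integrals, whereas
    the norm of [R[i]] takes its values in [R[i]]. *)
Lemma normc_ge_absRe z : `|complex.Re z| <= normc z.
Proof.
case: z => a b /=; rewrite -sqrtr_sqr ler_wsqrtr// lerDl sqr_ge0 //.
Qed.

Lemma normc_ge_absIm z : `|complex.Im z| <= normc z.
Proof.
case: z => a b /=; rewrite -sqrtr_sqr ler_wsqrtr// lerDr sqr_ge0 //.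
Qed.

Lemma normc_le_absReIm z : normc z <= `|complex.Re z| + `|complex.Im z|.
Proof.
case: z => a b /=; rewrite -[leRHS]ger0_norm ?addr_ge0// -sqrtr_sqr ler_wsqrtr//.
by rewrite sqrrD !real_normK ?num_real// addrAC lerDl mulrn_wge0// mulr_ge0.
Qed.

Lemma normc_ge0 z : 0 <= normc z.
Proof. exact: le_trans (normc_ge_absRe z). Qed.

Lemma normc_real (x : R) : normc x%:C = `|x|.
Proof. by rewrite /= expr0n addr0 sqrtr_sqr. Qed.

Lemma normc_cexp z : normc (cexp z) = expR (complex.Re z).
Proof.
rewrite /cexp ComplexField.Normc.normcM normc_real ger0_norm ?expR_ge0//.
by rewrite /= cos2Dsin2 sqrtr1 mulr1.
Qed.

Lemma normc_cpow (x : R) (s : R[i]) : 0 < x ->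
  normc (cpow x s) = x `^ complex.Re s.
Proof.
move=> x0; rewrite normc_cexp /powR gt_eqF//; congr expR.
by case: s => a b /=; rewrite mulr0 subr0.
Qed.

Lemma cexpD (u v : R[i]) : cexp (u + v) = cexp u * cexp v.
Proof.
case: u v => a b [c d]; rewrite /cexp /= expRD cosD sinD.
by apply/eqP; rewrite eq_complex /=; apply/andP; split; apply/eqP; ring.
Qed.

Lemma cexp0 : cexp 0 = 1 :> R[i].
Proof. by rewrite /cexp /= expR0 cos0 sin0 mul1r. Qed.

Lemma cexp_neq0 (u : R[i]) : cexp u != 0.
Proof.
apply/eqP => e0; have := cexpD u (- u); rewrite subrr cexp0 e0 mul0r.
by apply/eqP; exact: oner_neq0.
Qed.

Lemma cexp_real (x : R) : cexp x%:C = (expR x)%:C.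
Proof. by rewrite /cexp /= cos0 sin0 mulr1. Qed.

Lemma cpowD (x : R) (s t : R[i]) : cpow x (s + t) = cpow x s * cpow x t.
Proof. by rewrite /cpow mulrDl cexpD. Qed.

Lemma cpowN (x : R) (s : R[i]) : cpow x (- s) = (cpow x s)^-1.
Proof.
apply: (mulfI (cexp_neq0 (s * (ln x)%:C))).
rewrite -[X in X * _ = _]/(cpow x s) -cpowD subrr mulfV ?cexp_neq0//.
by rewrite /cpow mul0r cexp0.
Qed.

Lemma cpowM (x y : R) (s : R[i]) : 0 < x -> 0 < y ->
  cpow (x * y) s = cpow x s * cpow y s.
Proof.
by move=> x0 y0; rewrite /cpow lnM ?posrE// rmorphD/= mulrDr cexpD.
Qed.

Lemma cpow1 (x : R) : 0 < x -> cpow x 1 = x%:C.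
Proof. by move=> x0; rewrite /cpow mul1r cexp_real lnK. Qed.

Lemma cpow_real (x p : R) : 0 < x -> cpow x p%:C = (x `^ p)%:C.
Proof.
by move=> x0; rewrite /cpow -rmorphM/= cexp_real /powR gt_eqF.
Qed.

End normc.

Section cmeasurable.
Context d (T : measurableType d) (R : realType).
Implicit Types (D : set T) (f g : T -> R[i]).

Definition cmeasurable D f :=
  measurable_fun D (@complex.Re R \o f) /\ measurable_fun D (@complex.Im R \o f).

Lemma cmeasurableM D f g : cmeasurable D f -> cmeasurable D g ->
  cmeasurable D (fun x => f x * g x).
Proof.
move=> [rf jf] [rg jg]; split.
  rewrite (_ : _ \o _ = (fun x => complex.Re (f x) * complex.Re (g x) -
    complex.Im (f x) * complex.Im (g x))); last first.
    by apply/funext => x /=; case: (f x); case: (g x).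
  by apply: measurable_funB; apply: measurable_funM.
rewrite (_ : _ \o _ = (fun x => complex.Re (f x) * complex.Im (g x) +
    complex.Im (f x) * complex.Re (g x))); last first.
  by apply/funext => x /=; case: (f x); case: (g x).
by apply: measurable_funD; apply: measurable_funM.
Qed.

Lemma cmeasurable_real D (f : T -> R) : measurable_fun D f ->
  cmeasurable D (fun x => (f x)%:C).
Proof. by move=> mf; split => //; exact: measurable_cst. Qed.

Lemma cmeasurable_cst D (c : R[i]) : cmeasurable D (fun=> c).
Proof. by split; exact: measurable_cst. Qed.

Lemma cmeasurable_cexp D f : cmeasurable D f ->
  cmeasurable D (fun x => cexp (f x)).
Proof.
move=> [rf jf]; apply: cmeasurableM.
  by apply: cmeasurable_real; apply: measurableT_comp.
split.
  apply: (measurableT_comp (f := @cos R)) => //.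
  by apply: continuous_measurable_fun => x; exact: continuous_cos.
apply: (measurableT_comp (f := @sin R)) => //.
by apply: continuous_measurable_fun => x; exact: continuous_sin.
Qed.

Lemma cmeasurable_cpow D (f : T -> R) (s : R[i]) : measurable_fun D f ->
  cmeasurable D (fun x => cpow (f x) s).
Proof.
move=> mf; apply: cmeasurable_cexp; apply: cmeasurableM.
  exact: cmeasurable_cst.
by apply: cmeasurable_real; apply: measurableT_comp.
Qed.

Lemma cmeasurable_funS D E f : measurable E -> D `<=` E ->
  cmeasurable E f -> cmeasurable D f.
Proof. by move=> mE DE [rf jf]; split; apply: measurable_funS DE _. Qed.

End cmeasurable.

Section cintegral.
Context d (T : measurableType d) (R : realType).
Variables (mu : {measure set T -> \bar R}) (D : set T).
Hypothesis mD : measurable D.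
Implicit Types (f g : T -> R[i]).
Local Notation normc := (@ComplexField.Normc.normc R).

Lemma eq_cintegrable f g : {in D, f =1 g} ->
  cintegrable mu D f -> cintegrable mu D g.
Proof.
by move=> fg [rf jf]; split; [apply: eq_integrable rf|apply: eq_integrable jf];
  move=> // x xD /=; rewrite fg.
Qed.

Lemma eq_cintegral f g : {in D, f =1 g} ->
  cintegral mu D f = cintegral mu D g.
Proof.
by move=> fg; rewrite /cintegral; congr Complex; apply: eq_Rintegral => x xD /=;
  rewrite fg.
Qed.

Lemma cintegrable_le f (h : T -> R) : cmeasurable D f ->
  mu.-integrable D (EFin \o h) -> (forall x, D x -> normc (f x) <= h x) ->
  cintegrable mu D f.
Proof.
move=> [rf jf] hi fh; split; apply: le_integrable hi => //.
- exact/measurable_EFinP.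
- move=> x Dx /=; rewrite lee_fin.
  by rewrite (le_trans (normc_ge_absRe _))// (le_trans (fh _ Dx))// ler_norm.
- exact/measurable_EFinP.
- move=> x Dx /=; rewrite lee_fin.
  by rewrite (le_trans (normc_ge_absIm _))// (le_trans (fh _ Dx))// ler_norm.
Qed.

(** The factor 2 is the price of bounding real and imaginary parts separately; it is harmless for
    showing that a remainder tends to 0. *)
Lemma normc_cintegral_le f (h : T -> R) : cintegrable mu D f ->
  mu.-integrable D (EFin \o h) -> (forall x, D x -> normc (f x) <= h x) ->
  normc (cintegral mu D f) <= 2 * \int[mu]_(x in D) h x.
Proof.
move=> [rf jf] hi fh; apply: (le_trans (normc_le_absReIm _)) => /=.
rewrite mulr_natl mulr2n; apply: lerD.
  apply: (le_trans (le_normr_Rintegral mD rf)); apply: le_Rintegral => //.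
    exact: integrable_norm.
  by move=> x Dx; rewrite (le_trans (normc_ge_absRe _))// fh.
apply: (le_trans (le_normr_Rintegral mD jf)); apply: le_Rintegral => //.
  exact: integrable_norm.
by move=> x Dx; rewrite (le_trans (normc_ge_absIm _))// fh.
Qed.

Lemma cintegrableD f g : cintegrable mu D f -> cintegrable mu D g ->
  cintegrable mu D (fun x => f x + g x).
Proof.
move=> [rf jf] [rg jg]; split.
  apply: eq_integrable (integrableD mD rf rg) => // x _ /=.
  by case: (f x); case: (g x).
apply: eq_integrable (integrableD mD jf jg) => // x _ /=.
by case: (f x); case: (g x).
Qed.

Lemma cintegralD f g : cintegrable mu D f -> cintegrable mu D g ->
  cintegral mu D (fun x => f x + g x) = cintegral mu D f + cintegral mu D g.
Proof.
move=> [rf jf] [rg jg]; rewrite /cintegral /=.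
by congr Complex; rewrite -RintegralD//; apply: eq_Rintegral => x _ /=;
  case: (f x); case: (g x).
Qed.

Lemma cintegrableZ (c : R[i]) f : cintegrable mu D f ->
  cintegrable mu D (fun x => c * f x).
Proof.
case: c => a b [rf jf]; split.
  apply: eq_integrable (integrableB mD (integrableZl mD a rf)
    (integrableZl mD b jf)) => //.
  by move=> x _ /=; case: (f x).
apply: eq_integrable (integrableD mD (integrableZl mD a jf)
  (integrableZl mD b rf)) => //.
by move=> x _ /=; case: (f x).
Qed.

Lemma cintegralZ (c : R[i]) f : cintegrable mu D f ->
  cintegral mu D (fun x => c * f x) = c * cintegral mu D f.
Proof.
case: c => a b [rf jf]; rewrite /cintegral /=.
have ar := integrableZl mD a rf; have aj := integrableZl mD a jf.
have br := integrableZl mD b rf; have bj := integrableZl mD b jf.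
congr Complex.
  rewrite -!RintegralZl// -RintegralB//.
  by apply: eq_Rintegral => x _ /=; case: (f x).
rewrite -!RintegralZl// -RintegralD//.
by apply: eq_Rintegral => x _ /=; case: (f x).
Qed.

End cintegral.

Lemma cintegral_scale (R : realType) (c : R) (f : R -> R[i]) : 0 < c ->
  cmeasurable setT f -> cintegrable (@lebesgue_measure R) `]0, +oo[ f ->
  cintegral (@lebesgue_measure R) `]0, +oo[ (fun t => f (c * t)) =
  (c^-1)%:C * cintegral (@lebesgue_measure R) `]0, +oo[ f.
Proof.
move=> c0 [mr mj] [rf jf]; apply/eqP; rewrite eq_complex /= !mul0r subr0 addr0.
by rewrite -(Rintegral_scale c0 mr)// -(Rintegral_scale c0 mj)// !eqxx.
Qed.

(** * Fubini's theorem on a product domain *)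

Section Fubini_restrict.
Context d1 d2 (T1 : measurableType d1) (T2 : measurableType d2) (R : realType).
Variables (m1 : {sigma_finite_measure set T1 -> \bar R}).
Variables (m2 : {sigma_finite_measure set T2 -> \bar R}).
Variables (D1 : set T1) (D2 : set T2).
Hypotheses (mD1 : measurable D1) (mD2 : measurable D2).

Section real.
Variables (f : T1 -> T2 -> R) (h : T2 -> R).
Hypothesis mf : measurable_fun setT (fun z => f z.1 z.2).
Hypothesis if2 : forall x, D1 x -> m2.-integrable D2 (EFin \o f x).
Hypothesis if1 : forall y, D2 y -> m1.-integrable D1 (EFin \o f ^~ y).
Hypothesis ih : m2.-integrable D2 (EFin \o h).
Hypothesis fh : forall y, D2 y -> \int[m1]_(x in D1) `|f x y| <= h y.

(** Extension by 0 makes all integrals run over the whole spaces; the partial integrals of [F] are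
    then the inner integrals of [f], again extended by 0. *)
Let F := (EFin \o (fun z => f z.1 z.2)) \_ (D1 `*` D2).

Let patch1 x y : D1 x -> F (x, y) = ((EFin \o f x) \_ D2) y.
Proof. by move=> D1x; rewrite /F !patchE in_setX/= mem_set. Qed.

Let patch2 x y : D2 y -> F (x, y) = ((EFin \o f ^~ y) \_ D1) x.
Proof. by move=> D2y; rewrite /F !patchE in_setX/= (mem_set D2y) andbT. Qed.

Let int2E x :
  (\int[m2]_y F (x, y))%E =
  ((fun x => (\int[m2]_(y in D2) f x y)%:E) \_ D1) x.
Proof.
rewrite patchE; case: ifPn => xD1.
  rewrite inE in xD1.
  have -> : (\int[m2]_y F (x, y) = \int[m2]_(y in D2) (f x y)%:E)%E.
    by rewrite [RHS]integral_mkcond; apply: eq_integral => y _; exact: patch1.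
  by rewrite /Rintegral fineK// integrable_fin_num//; exact: if2.
by rewrite integral0_eq// => y _; rewrite /F patchE in_setX/= (negbTE xD1).
Qed.

Let int1E y :
  (\int[m1]_x F (x, y))%E =
  ((fun y => (\int[m1]_(x in D1) f x y)%:E) \_ D2) y.
Proof.
rewrite patchE; case: ifPn => yD2.
  rewrite inE in yD2.
  have -> : (\int[m1]_x F (x, y) = \int[m1]_(x in D1) (f x y)%:E)%E.
    by rewrite [RHS]integral_mkcond; apply: eq_integral => x _; exact: patch2.
  by rewrite /Rintegral fineK// integrable_fin_num//; exact: if1.
rewrite integral0_eq// => x _.
by rewrite /F patchE in_setX/= [X in _ && X](negbTE yD2) andbF.
Qed.

Let mF : measurable_fun setT F.
Proof.
apply/(measurable_restrictT _ _).1 => //; first exact: measurableX.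
by apply/measurable_EFinP; apply: measurable_funTS.
Qed.

(** Absolute integrability is checked by Tonelli with [x] as the inner variable, the order in which
    [h] bounds the inner integral. *)
Let iF : (m1 \x m2)%E.-integrable setT F.
Proof.
apply/(integrable21ltyP _ _ mF).
apply: (@le_lt_trans _ _ (\int[m2]_(y in D2) (h y)%:E)%E); last first.
  exact: integrable_lty.
rewrite [leRHS]integral_mkcond; apply: ge0_le_integral => //.
- by move=> y _; apply: integral_ge0.
- apply: (measurable_fun_fubini_tonelli_G (m1 := m1) (abse \o F)).
  exact: (measurableT_comp (@abse_measurable R setT) mF).
  by move=> z; exact: abse_ge0.
- apply/(measurable_restrictT _ _).1 => //.
  exact: measurable_int ih.
- move=> y _; rewrite patchE; case: ifPn => yD2.
    rewrite inE in yD2.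
    have -> : (\int[m1]_x `|F (x, y)| = \int[m1]_(x in D1) (`|f x y|)%:E)%E.
      rewrite [RHS]integral_mkcond; apply: eq_integral => x _.
      by rewrite patch2// !patchE; case: ifPn => //=; rewrite normr0.
    rewrite -[leLHS]fineK; first by rewrite lee_fin fh.
    by apply: integrable_fin_num => //; apply: integrable_norm; exact: if1.
  rewrite integral0_eq// => x _.
  by rewrite /F patchE in_setX/= (negbTE yD2) andbF abse0.
Qed.

Lemma integrable_Rintegral :
  m1.-integrable D1 (EFin \o (fun x => \int[m2]_(y in D2) f x y)).
Proof.
have := integrable_fubini_F iF; rewrite /fubini_F.
under [X in _.-integrable _ X]eq_fun do rewrite int2E.
by move/(integrable_mkcond _ mD1).
Qed.

Lemma Rintegral_Fubini :
  \int[m1]_(x in D1) \int[m2]_(y in D2) f x y =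
  \int[m2]_(y in D2) \int[m1]_(x in D1) f x y.
Proof.
have := Fubini iF.
under eq_integral do rewrite int2E.
under [X in _ = X -> _]eq_integral do rewrite int1E.
by rewrite -!integral_mkcond /Rintegral => ->.
Qed.

End real.

Local Notation normc := (@ComplexField.Normc.normc R).

Section complex.
Variables (f : T1 -> T2 -> R[i]) (g : T1 -> T2 -> R) (h : T2 -> R).
Hypothesis mf : cmeasurable setT (fun z => f z.1 z.2).
Hypothesis fg : forall x y, D1 x -> D2 y -> normc (f x y) <= g x y.
Hypothesis ig2 : forall x, D1 x -> m2.-integrable D2 (EFin \o g x).
Hypothesis ig1 : forall y, D2 y -> m1.-integrable D1 (EFin \o g ^~ y).
Hypothesis ih : m2.-integrable D2 (EFin \o h).
Hypothesis gh : forall y, D2 y -> \int[m1]_(x in D1) g x y <= h y.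

Let cif2 x : D1 x -> cintegrable m2 D2 (f x).
Proof.
move=> D1x; apply: (cintegrable_le mD2 _ (ig2 D1x)).
  by case: mf => rf jf; split; apply: measurable_funTS;
    [exact: (measurableT_comp rf (pair1_measurable x))|
     exact: (measurableT_comp jf (pair1_measurable x))].
by move=> y D2y; exact: fg.
Qed.

Let cif1 y : D2 y -> cintegrable m1 D1 (f ^~ y).
Proof.
move=> D2y; apply: (cintegrable_le mD1 _ (ig1 D2y)).
  by case: mf => rf jf; split; apply: measurable_funTS;
    [exact: (measurableT_comp rf (pair2_measurable y))|
     exact: (measurableT_comp jf (pair2_measurable y))].
by move=> x D1x; exact: fg.
Qed.

(** [p] stands for the real or the imaginary part. *)
Let le_int (p : R[i] -> R) y : (forall u, `|p u| <= normc u) -> D2 y ->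
  m1.-integrable D1 (EFin \o (fun x => p (f x y))) ->
  \int[m1]_(x in D1) `|p (f x y)| <= h y.
Proof.
move=> pn D2y pf; apply: (le_trans _ (gh D2y)); apply: le_Rintegral => //.
- exact: integrable_norm pf.
- exact: ig1.
- by move=> x D1x; rewrite (le_trans (pn _))// fg.
Qed.

Lemma cintegrable_cintegral :
  cintegrable m1 D1 (fun x => cintegral m2 D2 (f x)).
Proof.
case: mf => rf jf; split.
  apply: (@integrable_Rintegral (fun x y => complex.Re (f x y)) h) => //.
  - by move=> x /cif2[].
  - by move=> y /cif1[].
  - move=> y D2y; apply: le_int => //; first exact: normc_ge_absRe.
    by case: (cif1 D2y).
apply: (@integrable_Rintegral (fun x y => complex.Im (f x y)) h) => //.
- by move=> x /cif2[].
- by move=> y /cif1[].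
- move=> y D2y; apply: le_int => //; first exact: normc_ge_absIm.
  by case: (cif1 D2y).
Qed.

Lemma cintegral_Fubini :
  cintegral m1 D1 (fun x => cintegral m2 D2 (f x)) =
  cintegral m2 D2 (fun y => cintegral m1 D1 (f ^~ y)).
Proof.
case: mf => rf jf; rewrite {1 3}/cintegral; congr Complex.
  apply: (@Rintegral_Fubini (fun x y => complex.Re (f x y)) h) => //.
  - by move=> x /cif2[].
  - by move=> y /cif1[].
  - move=> y D2y; apply: le_int => //; first exact: normc_ge_absRe.
    by case: (cif1 D2y).
apply: (@Rintegral_Fubini (fun x y => complex.Im (f x y)) h) => //.
- by move=> x /cif2[].
- by move=> y /cif1[].
- move=> y D2y; apply: le_int => //; first exact: normc_ge_absIm.
  by case: (cif1 D2y).
Qed.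

End complex.
End Fubini_restrict.

(** * Euler's integral at positive real arguments *)

Section real_gamma.
Context (R : realType).
Implicit Types p q t : R.

Lemma integrable_itv0yZl (c : R) (f : R -> R) :
  lebesgue_measure.-integrable `]0, +oo[ (EFin \o f) ->
  lebesgue_measure.-integrable `]0, +oo[ (EFin \o (fun t => c * f t)).
Proof. by move=> fi; exact: (integrableZl _ c fi). Qed.

(* [q ln t - t] is maximal at [t = q]. *)
Lemma mul_ln_le q t : 0 < q -> 0 < t -> q * ln t <= t + (q * ln q - q).
Proof.
move=> q0 t0; have tq0 : 0 < t / q by rewrite divr_gt0.
have : ln (t / q) <= t / q - 1.
  by rewrite -{1}(subrKC 1 (t / q)) le_ln1Dx// ltrBrDl addrN.
rewrite ln_div ?posrE// lerBlDr -(ler_pM2l q0) => /le_trans; apply.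
by rewrite mulrDr mulrBr mulr1 mulrCA mulfV ?gt_eqF// mulr1 -addrA (addrC (- q)).
Qed.

(* The bound [e^-t <= C (1 + t)^-(p+1)] reduces this to a function with
   antiderivative [(t / (1 + t))^p / p]. *)
Lemma integrable_powRMexpN p : 0 < p ->
  lebesgue_measure.-integrable `]0, +oo[
    (EFin \o (fun t => t `^ (p - 1) * expR (- t))).
Proof.
move=> p0.
pose F t := p^-1 * expR (p * (ln t - ln (1 + t))).
pose f t := expR (p * (ln t - ln (1 + t))) * (t^-1 - (1 + t)^-1).
have p1 t : 0 < t -> 0 < 1 + t by move=> t0; rewrite addr_gt0.
have fi : lebesgue_measure.-integrable `]0, +oo[ (EFin \o f).
  apply: (@ge0_integrable_FTC0y _ f F _ _ p^-1).
  - move=> t t0; have d2 := is_derive1_ln t0; have d1 := is_derive1_ln (p1 _ t0).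
    have d3 : is_derive t 1 (fun t => ln (1 + t)) (1 + t)^-1.
      have d4 : is_derive t 1 (fun t => 1 + t) 1.
        have d4 := is_deriveD (is_derive_cst (1 : R) t (1 : R))
          (is_derive_id t (1 : R)).
        exact: (is_derive_eq d4 (add0r _)).
      exact: (is_derive_eq (is_derive1_comp (f := @ln R) d1 d4) (mulr1 _)).
    have d5 := is_deriveZ p (is_deriveB d2 d3).
    have d6 := is_deriveZ p^-1 (is_derive1_comp (is_derive_expR _) d5).
    apply: (is_derive_eq d6); rewrite /f /GRing.scale/=.
    by rewrite mulrCA mulKf ?gt_eqF.
  - move=> t t0.
    have c1 : {for t, continuous (fun t : R => 1 + t)}.
      by apply: continuousD; [exact: cst_continuous|by move=> ?].
    have c2 : {for t, continuous (fun t => p * (ln t - ln (1 + t)))}.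
      apply: continuousM; first exact: cst_continuous.
      apply: continuousB; first exact: continuous_ln.
      by apply: (continuous_comp c1); apply: continuous_ln; exact: p1.
    apply: continuousM.
      by apply: (continuous_comp c2); exact: continuous_expR.
    apply: continuousB; first by apply: inv_continuous; rewrite gt_eqF.
    by apply: (continuous_comp c1); apply: inv_continuous; rewrite gt_eqF// p1.
  - move=> t t0; rewrite mulr_ge0 ?expR_ge0// subr_ge0.
    by rewrite lef_pV2 ?posrE ?p1// lerDr.
  - move=> t t0; rewrite /F; apply/andP; split.
      by rewrite mulr_ge0 ?expR_ge0 ?invr_ge0 ?ltW.
    apply: ler_piMr; first by rewrite invr_ge0 ltW.
    rewrite expR_le1 pmulr_rle0// subr_le0.
    by rewrite ler_ln ?posrE ?p1// lerDr.
(* The constant is the one that [mul_ln_le] gives for (1 + t)^(p + 1) e^(-t), with [q = p + 1] at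
   the point [1 + t]. *)
have C0 := integrable_itv0yZl (expR ((p + 1) * ln (p + 1) - p)) fi.
apply: le_integrable C0 => //.
  apply/measurable_EFinP; apply: measurable_funTS; apply: measurable_funM.
    exact: measurable_powR.
  by apply: measurableT_comp => //; exact: oppr_measurable.
move=> t; rewrite /= in_itv/= andbT => t0.
rewrite lee_fin /f !ger0_norm ?mulr_ge0 ?powR_ge0 ?expR_ge0//; last first.
  by rewrite subr_ge0 lef_pV2 ?posrE ?p1// lerDr.
(* [f t] is t^(p - 1) (1 + t)^(-(p + 1)); once every factor is an exponential, comparing exponents
   is a linear consequence of [mul_ln_le]. *)
have -> : t^-1 - (1 + t)^-1 = expR (- ln t - ln (1 + t)).
  rewrite expRB expRN !lnK ?posrE ?p1//; field.
  by rewrite !gt_eqF ?p1.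
rewrite /powR gt_eqF// -!expRD ler_expR.
have := @mul_ln_le (p + 1) (1 + t); rewrite !addr_gt0// => /(_ isT isT); lra.
Qed.

Definition rgamma p : R :=
  \int[lebesgue_measure]_(t in `]0, +oo[) (t `^ (p - 1) * expR (- t)).

Lemma measurable_powRMexpN p (a : R) :
  measurable_fun setT (fun t => t `^ (p - 1) * expR (- (a * t))).
Proof.
apply: measurable_funM; first exact: measurable_powR.
apply: measurableT_comp => //; apply: measurableT_comp => //.
Qed.

Lemma powRMexpN_scale p (a t : R) : 0 < a -> 0 < t ->
  t `^ (p - 1) * expR (- (a * t)) =
  a `^ (1 - p) * ((a * t) `^ (p - 1) * expR (- (a * t))).
Proof.
move=> a0 t0; rewrite powRM ?ltW// 2!mulrA; congr (_ * _).
rewrite -powRD; last by rewrite (gt_eqF a0) implybT.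
by rewrite addrA subrK subrr powRr0 mul1r.
Qed.

Lemma integrable_powRMexpNM p (a : R) : 0 < p -> 0 < a ->
  lebesgue_measure.-integrable `]0, +oo[
    (EFin \o (fun t => t `^ (p - 1) * expR (- (a * t)))).
Proof.
move=> p0 a0.
have m1 : measurable_fun setT (fun t => t `^ (p - 1) * expR (- t)).
  under eq_fun do rewrite -[X in expR (- X)]mul1r.
  exact: measurable_powRMexpN.
have := integrable_itv0yZl (a `^ (1 - p))
  (integrable_scale a0 m1 (integrable_powRMexpN p0)).
apply: eq_integrable => //= t; rewrite inE/= in_itv/= andbT => t0.
by rewrite (powRMexpN_scale _ a0 t0).
Qed.

Lemma Rintegral_powRMexpN p (a : R) : 0 < p -> 0 < a ->
  \int[lebesgue_measure]_(t in `]0, +oo[) (t `^ (p - 1) * expR (- (a * t))) =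
  rgamma p * a `^ (- p).
Proof.
move=> p0 a0.
have m1 : measurable_fun setT (fun t => t `^ (p - 1) * expR (- t)).
  under eq_fun do rewrite -[X in expR (- X)]mul1r.
  exact: measurable_powRMexpN.
have i1 := integrable_powRMexpN p0.
transitivity (\int[lebesgue_measure]_(t in `]0, +oo[)
   (a `^ (1 - p) * ((a * t) `^ (p - 1) * expR (- (a * t))))).
  apply: eq_Rintegral => t; rewrite inE/= in_itv/= andbT => t0.
  exact: powRMexpN_scale.
rewrite RintegralZl//; last exact: (integrable_scale a0 m1).
rewrite (Rintegral_scale a0 m1)// -/(rgamma p) mulrA mulrC; congr (_ * _).
by rewrite -powR_inv1 ?ltW// -powRD ?(gt_eqF a0) ?implybT// addrAC subrr add0r.
Qed.

(** The integrand is nonnegative and at least [c] on [1, 2]: there |(p - 1) ln t| <= |p - 1| ln 2,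
    whatever the sign of p - 1, and e^(-t) >= e^(-2). *)
Lemma rgamma_gt0 p : 0 < p -> 0 < rgamma p.
Proof.
move=> p0; pose c : R := expR (- (`|p - 1| * ln 2) - 2).
apply: (@lt_le_trans _ _ (\int[lebesgue_measure]_(t in `[1, 2]) cst c t)).
  rewrite Rintegral_cst//= lebesgue_measure_itv/= lte_fin ltr1n/=.
  by rewrite mulr_gt0 ?expR_gt0// -EFinB/= addrK.
have s12 : `[1, 2] `<=` (`]0, +oo[ : set R).
  by move=> t; rewrite /= !in_itv/= andbT => /andP[+ _]; apply: lt_le_trans.
apply: (@le_trans _ _ (\int[lebesgue_measure]_(t in `[1, 2])
  (t `^ (p - 1) * expR (- t)))).
  apply: le_Rintegral => //.
  - apply: continuous_compact_integrable; first exact: segment_compact.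
    by apply: continuous_subspaceT => x; exact: cvg_cst.
  - by apply: integrableS (integrable_powRMexpN p0).
  - move=> t; rewrite /= in_itv/= => /andP[t1 t2].
    have t0 : 0 < t by apply: lt_le_trans t1.
    rewrite /c /powR gt_eqF// -expRD ler_expR lerD ?lerN2//.
    rewrite lerNl -mulNr; apply: (le_trans (ler_norm _)).
    rewrite normrM normrN ler_pM// ger0_norm ?ln_ge0// ler_ln ?posrE//.
rewrite /rgamma /Rintegral fine_le ?integrable_fin_num//.
- by apply: integrableS (integrable_powRMexpN p0).
- exact: integrable_powRMexpN.
apply: ge0_subset_integral => //.
- by apply: measurable_int (integrable_powRMexpN p0).
- by move=> t _; rewrite lee_fin mulr_ge0 ?powR_ge0 ?expR_ge0.
Qed.

Lemma powRN_cvg0 (p : R) (u : nat -> R) : 0 < p ->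
  u n @[n --> \oo] --> +oo%R -> u n `^ (- p) @[n --> \oo] --> 0.
Proof.
move=> p0 uoo; apply/cvgrPdist_lt => e e0.
near=> n.
(* For positive u, u^(-p) < e amounts to u > (1/e)^(1/p). *)
have un : (e^-1) `^ (p^-1) < u n by near: n; exact: cvgry_gt.
rewrite sub0r normrN ger0_norm ?powR_ge0// powRN.
rewrite invf_plt ?posrE//; last first.
  by rewrite powR_gt0// (le_lt_trans _ un)// powR_ge0.
rewrite -[ltLHS]powRr1 ?invr_ge0 ?ltW// -(mulVf (lt0r_neq0 p0)) powRrM.
by rewrite gt0_ltr_powR// nnegrE ?powR_ge0// ltW// (le_lt_trans _ un)// powR_ge0.
Unshelve. all: by end_near. Qed.

End real_gamma.

(** * The functional equation of Gamma *)

Lemma eq_cintegral_itv0y (R : realType) (f g : R -> R[i]) :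
  (forall t, 0 < t -> f t = g t) ->
  cintegral (@lebesgue_measure R) `]0, +oo[ f =
  cintegral (@lebesgue_measure R) `]0, +oo[ g.
Proof.
move=> fg; apply: eq_cintegral => t; rewrite inE/= in_itv/= andbT; exact: fg.
Qed.

Lemma eq_cintegrable_itv0y (R : realType) (f g : R -> R[i]) :
  (forall t, 0 < t -> f t = g t) ->
  cintegrable (@lebesgue_measure R) `]0, +oo[ f ->
  cintegrable (@lebesgue_measure R) `]0, +oo[ g.
Proof.
move=> fg; apply: eq_cintegrable => // t; rewrite inE/= in_itv/= andbT; exact: fg.
Qed.

Section gamma_rec.
Context (R : realType).

(* Take [(k, k')] to be [(cos, - sin)] or [(sin, cos)]: the integrand is the
   derivative of the real or imaginary part of [t^s e^-t], which vanishes at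
   both ends. *)
Lemma Rintegral_Gamma_boundary (a b : R) (k k' : R -> R) : 0 < a ->
  (forall x : R, is_derive x 1 k (k' x)) -> continuous k' ->
  (forall x, `|k x| <= 1) ->
  let f := fun t : R => expR (a * ln t - t) *
    ((a * t^-1 - 1) * k (b * ln t) + b * t^-1 * k' (b * ln t)) in
  lebesgue_measure.-integrable `]0, +oo[ (EFin \o f) ->
  \int[lebesgue_measure]_(t in `]0, +oo[) f t = 0.
Proof.
move=> a0 dk ck' k1 f fi.
pose F t := expR (a * ln t - t) * k (b * ln t).
have ck : continuous k.
  move=> x; apply: differentiable_continuous; apply/derivable1_diffP.
  by case: (dk x).
have FE t : `|F t| <= expR (a * ln t - t).
  by rewrite normrM ger0_norm ?expR_ge0// ler_piMr ?expR_ge0.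
rewrite (@Rintegral_FTC0y _ f F _ _ 0 0) ?subrr//.
- move=> t t0; have d1 := is_derive1_ln t0.
  have d2 := is_derive1_comp (is_derive_expR _)
    (is_deriveB (is_deriveZ a d1) (is_derive_id t (1 : R))).
  have d3 := is_derive1_comp (dk _) (is_deriveZ b d1).
  apply: (is_derive_eq (is_deriveM d2 d3)); rewrite /f /GRing.scale /=.
  ring.
- move=> t t0; have cl : {for t, continuous (@ln R)} by exact: continuous_ln.
  have cbl : {for t, continuous (fun t => b * ln t)}.
    by apply: continuousM => //; exact: cst_continuous.
  have cv : {for t, continuous (fun t : R => t^-1)}.
    by apply: inv_continuous; rewrite gt_eqF.
  have ce : {for t, continuous (fun t => a * ln t - t)}.
    apply: continuousB; last by move=> ?.
    by apply: continuousM => //; exact: cst_continuous.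
  have c1 : {for t, continuous (fun t => expR (a * ln t - t))}.
    by apply: (continuous_comp ce); exact: continuous_expR.
  have c2 : {for t, continuous (fun t => k (b * ln t))}.
    by apply: (continuous_comp cbl); exact: ck.
  have c3 : {for t, continuous (fun t => k' (b * ln t))}.
    by apply: (continuous_comp cbl); exact: ck'.
  have c4 : {for t, continuous (fun t : R => a * t^-1 - 1)}.
    apply: continuousB; last exact: cst_continuous.
    by apply: continuousM => //; exact: cst_continuous.
  have c5 : {for t, continuous (fun t : R => b * t^-1)}.
    by apply: continuousM => //; exact: cst_continuous.
  exact: (continuousM c1 (continuousD (continuousM c4 c2) (continuousM c5 c3))).
(* At t = 1/(n + 1), the bound e^(-t) <= 1 leaves t^a = (n + 1)^(-a). *)
- apply/norm_cvg0P; apply: (@squeeze_cvgr _ _ _ _ (fun=> 0)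
    (fun n => n.+1%:R `^ (- a))).
  + apply: nearW => n; rewrite normr_ge0/= (le_trans (FE _))//.
    rewrite /powR gt_eqF// ler_expR lnV ?posrE// mulrN mulNr.
    by rewrite gerBl invr_ge0.
  + exact: cvg_cst.
  + apply: powRN_cvg0 => //.
    by rewrite (cvg_shiftS (fun n => n%:R : R)); exact: cvgr_idn.
(* At t = n + 1, [mul_ln_le] with exponent [a + 1] gives t^a e^(-t) <= C / t. *)
- apply/norm_cvg0P; apply: (@squeeze_cvgr _ _ _ _ (fun=> 0)
    (fun n => expR ((a + 1) * ln (a + 1) - (a + 1)) * n.+1%:R `^ (- 1))).
  + apply: nearW => n; rewrite normr_ge0/= (le_trans (FE _))//.
    rewrite /powR gt_eqF// -expRD ler_expR.
    have := mul_ln_le (addr_gt0 a0 ltr01) (ltr0Sn R n); lra.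
  + exact: cvg_cst.
  + rewrite -[X in _ --> X](mulr0 (expR ((a + 1) * ln (a + 1) - (a + 1)))).
    apply: cvgM; first exact: cvg_cst.
    apply: powRN_cvg0 => //.
    by rewrite (cvg_shiftS (fun n => n%:R : R)); exact: cvgr_idn.
Qed.

Lemma cmeasurable_cpowMexpN (s : R[i]) (a : R) :
  cmeasurable setT (fun t : R => cpow t (s - 1) * (expR (- (a * t)))%:C).
Proof.
apply: cmeasurableM; first exact: cmeasurable_cpow.
apply: cmeasurable_real; apply: measurableT_comp => //.
by apply: measurableT_comp => //; exact: mulrl_measurable.
Qed.

Lemma cmeasurable_Gamma (s : R[i]) :
  cmeasurable setT (fun t : R => cpow t (s - 1) * (expR (- t))%:C).
Proof.
rewrite (_ : (fun _ => _) =
  (fun t : R => cpow t (s - 1) * (expR (- (1 * t)))%:C)).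
  exact: cmeasurable_cpowMexpN.
by apply/funext => t; rewrite mul1r.
Qed.

Lemma normc_cpowMexpN (s : R[i]) (a t : R) : 0 < t ->
  ComplexField.Normc.normc (cpow t (s - 1) * (expR (- (a * t)))%:C) =
  t `^ (complex.Re s - 1) * expR (- (a * t)).
Proof.
move=> t0; rewrite ComplexField.Normc.normcM normc_cpow// normc_real.
by rewrite ger0_norm ?expR_ge0//; case: s => x y /=.
Qed.

Lemma cintegrable_cpowMexpN (s : R[i]) (a : R) : 0 < complex.Re s -> 0 < a ->
  cintegrable (@lebesgue_measure R) `]0, +oo[
    (fun t : R => cpow t (s - 1) * (expR (- (a * t)))%:C).
Proof.
move=> s0 a0; apply: (cintegrable_le _ _ (integrable_powRMexpNM s0 a0)) => //.
- apply: (@cmeasurable_funS _ _ _ _ setT) => //; exact: cmeasurable_cpowMexpN.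
- move=> t tI; rewrite normc_cpowMexpN//.
  by move: tI; rewrite /= in_itv/= andbT.
Qed.

Lemma cintegrable_Gamma (s : R[i]) : 0 < complex.Re s ->
  cintegrable (@lebesgue_measure R) `]0, +oo[
    (fun t : R => cpow t (s - 1) * (expR (- t))%:C).
Proof.
move=> s0; apply: eq_cintegrable (cintegrable_cpowMexpN s0 (ltr01)) => //.
by move=> t _; rewrite mul1r.
Qed.

(** Scaling t by [a] produces a^(s - 1) on one side and 1/a on the other; reading 1/a as a complex
    power lets them combine to a^(-s). *)
Lemma cintegral_cpowMexpN (s : R[i]) (a : R) : 0 < complex.Re s -> 0 < a ->
  cintegral (@lebesgue_measure R) `]0, +oo[
    (fun t : R => cpow t (s - 1) * (expR (- (a * t)))%:C) =
  Gamma s * cpow a (- s).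
Proof.
move=> s0 a0; have mG := cmeasurable_Gamma s; have iG := cintegrable_Gamma s0.
have := cintegral_scale a0 mG iG; rewrite -/(Gamma s).
have -> : (a^-1)%:C = cpow a (-1) :> R[i].
  by rewrite cpowN cpow1// fmorphV.
rewrite (@eq_cintegral_itv0y _ _ (fun t => cpow a (s - 1) *
   (cpow t (s - 1) * (expR (- (a * t)))%:C))); last first.
  by move=> t t0; rewrite cpowM// mulrA.
rewrite cintegralZ//; last exact: cintegrable_cpowMexpN.
rewrite cpowD mulrAC mulrC => /(mulfI (cexp_neq0 _)) <-.
by rewrite mulrAC -cpowD subrr /cpow mul0r cexp0 mul1r.
Qed.

(** s Gamma(s) - Gamma(s + 1) is merged into one integral, whose integrand is the derivative of t^s
    e^(-t). *)
Lemma Gamma_rec (s : R[i]) : 0 < complex.Re s -> Gamma (s + 1) = s * Gamma s.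
Proof.
move=> s0; have iG := cintegrable_Gamma s0.
have iG1 : cintegrable (@lebesgue_measure R) `]0, +oo[
    (fun t : R => cpow t (s + 1 - 1) * (expR (- t))%:C).
  by apply: cintegrable_Gamma; case: s s0 {iG} => x y /= x0; rewrite addr_gt0.
apply/esym/eqP; rewrite -subr_eq0 -mulN1r; apply/eqP.
rewrite /Gamma -!cintegralZ// -cintegralD//; last 2 first.
- exact: cintegrableZ.
- exact: cintegrableZ.
have iD : cintegrable (@lebesgue_measure R) `]0, +oo[ (fun t : R =>
    s * (cpow t (s - 1) * (expR (- t))%:C) +
    -1 * (cpow t (s + 1 - 1) * (expR (- t))%:C)).
  by apply: cintegrableD => //; exact: cintegrableZ.
set f := fun t : R => _ in iD *.
pose a := complex.Re s; pose b := complex.Im s.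
pose g k k' (t : R) := expR (a * ln t - t) *
    ((a * t^-1 - 1) * k (b * ln t) + b * t^-1 * k' (b * ln t)).
(* The integrand is t^s e^(-t) (s/t - 1), where t^s has modulus e^(a ln t) and argument b ln t. *)
have fE : forall t, 0 < t -> f t = g cos (fun x => - sin x) t +i* g sin cos t.
  move=> t t0; rewrite /f addrK cpowD cpowN cpow1// /g /a /b /cpow /cexp expRB.
  rewrite -fmorphV/=.
  case: s {iG iG1 iD f a b g s0} => x y /=; rewrite expRN.
  apply/eqP; rewrite eq_complex /= !(mulr0, mul0r, subr0, addr0).
  apply/andP; split; apply/eqP; rewrite !add0r; ring.
rewrite (eq_cintegral_itv0y fE) /cintegral /=.
have [ri ji] := eq_cintegrable_itv0y fE iD.
congr Complex.
  apply: (@Rintegral_Gamma_boundary a b cos (fun x => - sin x) s0) => //.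
  - by move=> x; apply: continuousN; exact: continuous_sin.
  - exact: cos_max.
apply: (@Rintegral_Gamma_boundary a b sin cos s0) => //.
- exact: continuous_cos.
- exact: sin_max.
Qed.

End gamma_rec.

(** * Gamma has no zero in the right half-plane *)

Section gamma_neq0.
Context (R : realType).

Lemma Gamma_real (p : R) : 0 < p -> Gamma p%:C = (rgamma p)%:C.
Proof.
move=> p0; rewrite /Gamma.
rewrite (@eq_cintegral_itv0y _ _ (fun t => (t `^ (p - 1) * expR (- t))%:C)).
  by rewrite /cintegral /= /rgamma; congr Complex; rewrite /Rintegral integral0_eq.
by move=> t t0; rewrite -(rmorphB _ p 1) cpow_real// rmorphM.
Qed.

Lemma rgamma_rec (p : R) : 0 < p -> rgamma (p + 1) = p * rgamma p.
Proof.
move=> p0; apply: (@complexI R); rewrite rmorphM/= -!Gamma_real ?addr_gt0//.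
by rewrite rmorphD/= Gamma_rec.
Qed.

(** With y the square root of x, x - 2 + 1/x is the square of y - 1/y = 2 sinh(ln x / 2). Using v <=
    2 sinh v rather than the sharper 2v <= 2 sinh v costs the factor 4. *)
Lemma sqr_ln_le (x : R) : 0 < x -> ln x ^+ 2 <= 4 * (x - 2 + x^-1).
Proof.
have sinh_ge (v : R) : 0 <= v -> v <= expR v - expR (- v).
  move=> v0; have := expR_ge1Dx v.
  have : expR (- v) <= 1 by rewrite expR_le1 oppr_le0.
  lra.
have sqr_sinh_ge (v : R) : v ^+ 2 <= (expR v - expR (- v)) ^+ 2.
  wlog v0 : v / 0 <= v => [hw|].
    have [/hw//|/ltW v0] := leP 0 v.
    have := hw (- v); rewrite opprK oppr_ge0 => /(_ v0).
    by rewrite sqrrN -opprB sqrrN.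
  rewrite ler_sqr ?nnegrE ?sinh_ge//.
  by rewrite (le_trans v0)// sinh_ge.
move=> x0; have := sqr_sinh_ge (ln x / 2).
have e2 : expR (ln x / 2) * expR (ln x / 2) = x.
  by rewrite -expRD -splitr lnK.
rewrite expRN; set y := expR _ in e2 *.
have y0 : y != 0 by rewrite gt_eqF// expR_gt0.
have -> : (y - y^-1) ^+ 2 = x - 2 + x^-1 by rewrite -e2; field.
have -> : (ln x / 2) ^+ 2 = ln x ^+ 2 / 4 by field.
lra.
Qed.

Lemma normr_sin_le (x : R) : `|sin x| <= `|x|.
Proof.
wlog x0 : x / 0 < x => [hw|].
  have [x0|x0|<-] := ltgtP 0 x; first exact: hw.
    by have := hw (- x); rewrite sinN !normrN oppr_gt0; apply.
  by rewrite sin0.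
have [|c _] := @MVT R sin cos 0 x x0.
  by apply: continuous_subspaceT => y; exact: continuous_sin.
rewrite sin0 !subr0 => ->; rewrite normrM -[leRHS]mul1r.
by rewrite ler_wpM2r// cos_max.
Qed.

(** Half-angle formula: cos x = 1 - 2 sin(x/2)^2, and |sin y| <= |y|. *)
Lemma cos_ge (x : R) : 1 - x ^+ 2 / 2 <= cos x.
Proof.
have -> : x = (x / 2) *+ 2 by rewrite mulr2n -splitr.
set y := x / 2; have := normr_sin_le y.
rewrite -ler_sqr ?nnegrE// !real_normK ?num_real//.
rewrite cos_mulr2n; have := cos2Dsin2 y.
have -> : (y *+ 2) ^+ 2 / 2 = y ^+ 2 *+ 2 by field.
lra.
Qed.

(* The Gamma distribution of parameter [p] concentrates around [t = p], where
   [(t / p)^(i tau)] is close to [1]. *)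
Lemma Gamma_neq0_large (p tau : R) : 1 + 2 * tau ^+ 2 < p ->
  Gamma (p +i* tau) != 0.
Proof.
move=> ptau.
have p1 : 1 < p by rewrite (le_lt_trans _ ptau)// lerDl mulr_ge0// sqr_ge0.
have p0 : 0 < p by exact: lt_trans p1.
have p10 : 0 < p - 1 by rewrite subr_gt0.
have p2 : 0 < p + 1 by rewrite addr_gt0.
apply/eqP => G0.
(* This factor turns the phase tau ln t into tau (ln t - ln p), which vanishes at t = p. *)
pose c : R[i] := cpow p (0 -i* tau).
have iG := @cintegrable_Gamma R (p +i* tau) p0.
have : complex.Re (c * Gamma (p +i* tau)) = 0 by rewrite G0 mulr0.
rewrite /Gamma -cintegralZ// /cintegral /=.
pose f t := complex.Re (c * (cpow t (p +i* tau - 1) * (expR (- t))%:C)).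
have [fi _] : cintegrable (@lebesgue_measure R) `]0, +oo[
    (fun t => c * (cpow t (p +i* tau - 1) * (expR (- t))%:C)).
  exact: cintegrableZ.
move=> f0.
pose h q (t : R) := t `^ (q - 1) * expR (- t).
have hi q : 0 < q -> lebesgue_measure.-integrable `]0, +oo[ (EFin \o h q).
  exact: integrable_powRMexpN.
(* Expansion of h p t (1 - 2 tau^2 (t/p - 2 + p/t)), the minorant of [f]: multiplying or dividing
   [h p t] by t shifts p by one, so each term integrates to a multiple of a value of [rgamma]. *)
pose g t := (1 + 4 * tau ^+ 2) * h p t -
  (2 * tau ^+ 2 / p * h (p + 1) t + 2 * tau ^+ 2 * p * h (p - 1) t).
have i1 := integrable_itv0yZl (1 + 4 * tau ^+ 2) (hi _ p0).
have i2 := integrable_itv0yZl (2 * tau ^+ 2 / p) (hi _ p2).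
have i3 := integrable_itv0yZl (2 * tau ^+ 2 * p) (hi _ p10).
have i4 : lebesgue_measure.-integrable `]0, +oo[ (EFin \o (fun t =>
    2 * tau ^+ 2 / p * h (p + 1) t + 2 * tau ^+ 2 * p * h (p - 1) t)).
  exact: (integrableD _ i2 i3).
have gi : lebesgue_measure.-integrable `]0, +oo[ (EFin \o g).
  exact: (integrableB _ i1 i4).
have gE : \int[lebesgue_measure]_(t in `]0, +oo[) g t =
    rgamma p * (1 - 2 * tau ^+ 2 / (p - 1)).
  rewrite RintegralB// RintegralD// !RintegralZl ?hi//.
  have hE q : \int[lebesgue_measure]_(t in `]0, +oo[) h q t = rgamma q by [].
  rewrite !hE rgamma_rec//.
  have -> : rgamma p = (p - 1) * rgamma (p - 1) by rewrite -rgamma_rec// subrK.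
  field.
  by rewrite !gt_eqF.
have : \int[lebesgue_measure]_(t in `]0, +oo[) g t <= 0.
  suff : \int[lebesgue_measure]_(t in `]0, +oo[) g t <=
      \int[lebesgue_measure]_(t in `]0, +oo[) f t by rewrite [leRHS]f0.
  apply: le_Rintegral => // t; rewrite /= in_itv/= andbT => t0.
  have lnE : 1 - 2 * tau ^+ 2 * (t / p - 2 + p / t) <= cos (tau * (ln t - ln p)).
    apply: le_trans (cos_ge _); rewrite lerD2l lerN2 exprMn.
    have := @sqr_ln_le (t / p) (divr_gt0 t0 p0).
    rewrite ln_div ?posrE// invf_div.
    move=> /(ler_wpM2l (sqr_ge0 tau)); lra.
  have -> : f t = h p t * cos (tau * (ln t - ln p)).
    have ReE (u : R[i]) (e : R) :
        complex.Re (cexp u * e%:C) = expR (complex.Re u) * e * cos (complex.Im u).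
      by rewrite /cexp /=; ring.
    rewrite /f /c /cpow mulrA -cexpD ReE /h /powR gt_eqF//=.
    congr (expR _ * _ * cos _); ring.
  have -> : g t = h p t * (1 - 2 * tau ^+ 2 * (t / p - 2 + p / t)).
    have hp1 : h (p + 1) t = t * h p t.
      rewrite /h mulrA addrAC powRD ?(gt_eqF t0) ?implybT// powRr1 ?ltW//.
      by rewrite [t * _]mulrC.
    have hm1 : h (p - 1) t = t^-1 * h p t.
      rewrite /h mulrA powRD ?(gt_eqF t0) ?implybT// powR_inv1 ?ltW//.
      by rewrite [t^-1 * _]mulrC.
    rewrite /g hp1 hm1; field.
    by rewrite !gt_eqF.
  by rewrite ler_wpM2l// mulr_ge0 ?powR_ge0 ?expR_ge0.
rewrite gE leNgt mulr_gt0 ?rgamma_gt0// subr_gt0 ltr_pdivrMr// mul1r.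
by rewrite ltrBrDl.
Qed.

(** A zero at s would recur at every s + n. The threshold 1 + 2 tau^2 depends only on the imaginary
    part, which stays fixed, so it is eventually passed. *)
Lemma Gamma_neq0 (s : R[i]) : 0 < complex.Re s -> Gamma s != 0.
Proof.
case: s => p tau /= p0; apply/eqP => G0.
have G0n n : Gamma ((p + n%:R) +i* tau) = 0.
  elim: n => [|n IH]; first by rewrite addr0.
  have -> : (p + n.+1%:R) +i* tau = (p + n%:R) +i* tau + 1 :> R[i].
    by apply/eqP; rewrite eq_complex/= addr0 -addrA natr1 !eqxx.
  by rewrite Gamma_rec ?IH ?mulr0//= ltr_wpDr.
pose n := Num.Def.trunc (1 + 2 * tau ^+ 2).
have : 1 + 2 * tau ^+ 2 < p + n.+1%:R.
  by rewrite (lt_le_trans (truncnS_gt _))// lerDr ltW.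
by move/Gamma_neq0_large; rewrite G0n eqxx.
Qed.

End gamma_neq0.

(** * Integral representation of the alternating zeta function *)

Section eta.
Context (R : realType).
Local Notation normc := (@ComplexField.Normc.normc R).

Definition eta_weight (a t : R) : R := expR (- (a * t)) * (1 + expR (- t))^-1.

Lemma eta_weight_ge0 a t : 0 <= eta_weight a t.
Proof. by rewrite mulr_ge0 ?invr_ge0 ?addr_ge0 ?expR_ge0. Qed.

Lemma eta_weight_le a t : eta_weight a t <= expR (- (a * t)).
Proof.
by rewrite ler_piMr ?expR_ge0// invf_le1 ?lerDl ?expR_ge0// ltr_pwDl ?expR_ge0.
Qed.

(** A shift of the parameter comes out as an exponential: c = 1 yields the telescoping relation, and
    c = v yields a Gamma integral in v. *)
Lemma eta_weightD a c t :
  eta_weight (a + c) t = expR (- (c * t)) * eta_weight a t.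
Proof. by rewrite /eta_weight mulrDl opprD addrC expRD mulrA. Qed.

Lemma eta_weight_rec a t :
  eta_weight a t + eta_weight (a + 1) t = expR (- (a * t)).
Proof.
by rewrite eta_weightD mul1r -[X in X + _]mul1r -mulrDl mulrCA mulfV ?mulr1.
Qed.

Lemma measurable_inv1DexpN :
  measurable_fun setT (fun t : R => (1 + expR (- t))^-1).
Proof.
apply: continuous_measurable_fun => t.
have ce : {for t, continuous (fun t : R => 1 + expR (- t))}.
  apply: continuousD; first exact: cst_continuous.
  apply: (continuous_comp (f := -%R)); first exact: opp_continuous.
  exact: continuous_expR.
apply: (continuous_comp ce); apply: inv_continuous.
by rewrite gt_eqF// ltr_pwDl ?expR_ge0.
Qed.

Definition eta_kernel (s : R[i]) (a t : R) : R[i] :=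
  cpow t (s - 1) * (eta_weight a t)%:C.

Definition eta_int (s : R[i]) (a : R) : R[i] :=
  cintegral (@lebesgue_measure R) `]0, +oo[ (eta_kernel s a).

Lemma normc_eta_kernel_le s a t : 0 < t ->
  normc (eta_kernel s a t) <= t `^ (complex.Re s - 1) * expR (- (a * t)).
Proof.
move=> t0; rewrite ComplexField.Normc.normcM normc_cpow// normc_real.
rewrite ger0_norm ?eta_weight_ge0//; case: s => x y /=.
by rewrite ler_wpM2l ?powR_ge0// eta_weight_le.
Qed.

Lemma cmeasurable_eta_kernel s a : cmeasurable setT (eta_kernel s a).
Proof.
apply: cmeasurableM; first exact: cmeasurable_cpow.
apply: cmeasurable_real; apply: measurable_funM; last exact: measurable_inv1DexpN.
by apply: measurableT_comp => //; apply: measurableT_comp.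
Qed.

Lemma cintegrable_eta_kernel s a : 0 < complex.Re s -> 0 < a ->
  cintegrable (@lebesgue_measure R) `]0, +oo[ (eta_kernel s a).
Proof.
move=> s0 a0; apply: (cintegrable_le _ _ (integrable_powRMexpNM s0 a0)) => //.
- by apply: (@cmeasurable_funS _ _ _ _ setT) => //; exact: cmeasurable_eta_kernel.
- move=> t tI; apply: normc_eta_kernel_le.
  by move: tI; rewrite /= in_itv/= andbT.
Qed.

Lemma normc_eta_int_le s a : 0 < complex.Re s -> 0 < a ->
  normc (eta_int s a) <= 2 * (rgamma (complex.Re s) * a `^ (- complex.Re s)).
Proof.
move=> s0 a0; rewrite -Rintegral_powRMexpN//.
apply: normc_cintegral_le => //.
- exact: cintegrable_eta_kernel.
- exact: integrable_powRMexpNM.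
- move=> t tI; apply: normc_eta_kernel_le.
  by move: tI; rewrite /= in_itv/= andbT.
Qed.

Lemma eta_int_rec s a : 0 < complex.Re s -> 0 < a ->
  eta_int s a + eta_int s (a + 1) = Gamma s * cpow a (- s).
Proof.
move=> s0 a0; rewrite -cintegral_cpowMexpN// -cintegralD//.
- apply: eq_cintegral_itv0y => t t0.
  by rewrite /eta_kernel -mulrDr -rmorphD/= eta_weight_rec.
- exact: cintegrable_eta_kernel.
- by apply: cintegrable_eta_kernel => //; rewrite addr_gt0.
Qed.

Lemma alt_series_eta_int s a n : 0 < complex.Re s -> 0 < a ->
  Gamma s * series (fun k => (-1) ^+ k / cpow (k%:R + a) s) n =
  eta_int s a - (-1) ^+ n * eta_int s (n%:R + a).
Proof.
move=> s0 a0; elim: n => [|n IH].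
  by rewrite /series/= big_geq// mulr0 expr0 mul1r add0r subrr.
rewrite seriesSr mulrDr IH -cpowN mulrCA -eta_int_rec//; last first.
  by rewrite ltr_wpDl.
by rewrite exprS mulN1r mulNr opprK mulrDr addrA subrK -natr1 addrAC.
Qed.

Lemma alt_hurwitz_zetaE s a : 0 < complex.Re s -> 0 < a ->
  alt_hurwitz_zeta s a = eta_int s a / Gamma s.
Proof.
move=> s0 a0; have G0 := Gamma_neq0 s0.
rewrite /alt_hurwitz_zeta; apply: (@cvg_lim R[i]^o); first exact: norm_hausdorff.
apply/cvgrPdist_lt => e e0.
(* The radius [e] lives in [R[i]]; being positive for the order of [R[i]], it is real. *)
have eE : e = (complex.Re e)%:C.
  by apply/esym; apply: RRe_real; exact: gtr0_real.
have re0 : 0 < complex.Re e by rewrite -ltcR -eE.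
(* The constant of [normc_eta_int_le], divided by the modulus of [Gamma s]. *)
pose C := 2 * rgamma (complex.Re s) / normc (Gamma s).
have Gn0 : normc (Gamma s) != 0.
  by apply/eqP => /ComplexField.Normc.eq0_normc /eqP; rewrite (negbTE G0).
have un : C * (n%:R + a) `^ (- complex.Re s) @[n --> \oo] --> 0.
  rewrite -[X in _ --> X](mulr0 C); apply: cvgM; first exact: cvg_cst.
  apply: powRN_cvg0 => //; apply: (ger_cvgy (f := fun n : nat => n%:R : R)).
    by apply: nearW => n; rewrite lerDl ltW.
  exact: cvgr_idn.
near=> n.
have : `|0 - C * (n%:R + a) `^ (- complex.Re s)| < complex.Re e.
  by near: n; exact: (cvgrPdist_lt _ _).1.
have na0 : 0 < n%:R + a by rewrite ltr_wpDl.
have Cn : normc ((-1) ^+ n * eta_int s (n%:R + a) / Gamma s) <=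
    C * (n%:R + a) `^ (- complex.Re s).
  rewrite !ComplexField.Normc.normcM ComplexField.Normc.normcV.
  have -> : normc ((-1) ^+ n) = 1.
    elim: (n) => [|k IH]; first by rewrite expr0 ComplexField.Normc.normc1.
    rewrite exprS ComplexField.Normc.normcM IH mulr1.
    by rewrite -(rmorph1 (real_complex R)) -rmorphN normc_real normrN1.
  rewrite mul1r /C mulrAC ler_wpM2r ?invr_ge0 ?normc_ge0// -mulrA.
  exact: normc_eta_int_le.
have -> : eta_int s a / Gamma s -
    series (fun k => (-1) ^+ k / cpow (k%:R + a) s) n =
    (-1) ^+ n * eta_int s (n%:R + a) / Gamma s.
  rewrite -[series _ n](mulKf G0) alt_series_eta_int// mulrC -mulrBr.
  by rewrite opprB addrC subrK mulrC.
rewrite sub0r normrN => Ce.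
rewrite eE [ltLHS](_ : _ =
  (normc ((-1) ^+ n * eta_int s (n%:R + a) / Gamma s))%:C)//.
rewrite ltcR (le_lt_trans Cn)// (le_lt_trans _ Ce)// ler_norm.
Unshelve. all: by end_near. Qed.

End eta.

(** * The Mellin transform *)

Section mellin.
Context (R : realType) (s z : R[i]) (a : R).
Hypotheses (z0 : 0 < complex.Re z) (sz0 : 0 < complex.Re (s - z)) (a0 : 0 < a).
Local Notation normc := (@ComplexField.Normc.normc R).

Let f (v t : R) : R[i] := cpow v (z - 1) * eta_kernel s (v + a) t.
(** [g] bounds the modulus of [f] by replacing K with 1; its integral over v is exactly [h]. *)
Let g (v t : R) : R := v `^ (complex.Re z - 1) *
  (t `^ (complex.Re s - 1) * expR (- ((v + a) * t))).
Let h (t : R) : R := rgamma (complex.Re z) *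
  (t `^ (complex.Re (s - z) - 1) * expR (- (a * t))).

Let s0 : 0 < complex.Re s.
Proof.
have -> : s = (s - z) + z by rewrite subrK.
by move: z0 sz0; case: (s - z) => x y; case: z => x' y' /= *; rewrite addr_gt0.
Qed.

Let mf : cmeasurable setT (fun p : R * R => f p.1 p.2).
Proof.
have m1 : measurable_fun setT (fun p : R * R => p.1) by exact: measurable_fst.
have m2 : measurable_fun setT (fun p : R * R => p.2) by exact: measurable_snd.
apply: cmeasurableM; first exact: cmeasurable_cpow.
apply: cmeasurableM; first exact: cmeasurable_cpow.
apply: cmeasurable_real; apply: measurable_funM.
  apply: measurableT_comp => //; apply: measurableT_comp => //.
  by apply: measurable_funM => //; apply: measurable_funD.
by apply: (measurableT_comp (@measurable_inv1DexpN R)).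
Qed.

Let fg v t : 0 < v -> 0 < t -> normc (f v t) <= g v t.
Proof.
move=> v0 t0; rewrite ComplexField.Normc.normcM normc_cpow//.
have -> : complex.Re (z - 1) = complex.Re z - 1 by case: (z).
by rewrite ler_wpM2l ?powR_ge0// normc_eta_kernel_le.
Qed.

Let ig2 v : 0 < v -> lebesgue_measure.-integrable `]0, +oo[ (EFin \o g v).
Proof.
move=> v0; apply: integrable_itv0yZl; apply: integrable_powRMexpNM => //.
by rewrite addr_gt0.
Qed.

(** As a function of v, [g] is a constant times a Gamma integrand with rate t. *)
Let gE v t : g v t = t `^ (complex.Re s - 1) * expR (- (a * t)) *
  (v `^ (complex.Re z - 1) * expR (- (t * v))).
Proof. by rewrite /g mulrDl opprD expRD (mulrC t v); ring. Qed.

Let ig1 t : 0 < t -> lebesgue_measure.-integrable `]0, +oo[ (EFin \o g ^~ t).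
Proof.
move=> t0; rewrite (_ : g ^~ t = (fun v =>
  t `^ (complex.Re s - 1) * expR (- (a * t)) *
  (v `^ (complex.Re z - 1) * expR (- (t * v))))); last exact/funext.
by apply: integrable_itv0yZl; exact: integrable_powRMexpNM.
Qed.

Let gh t : 0 < t -> \int[lebesgue_measure]_(v in `]0, +oo[) g v t = h t.
Proof.
move=> t0; rewrite (_ : g ^~ t = (fun v =>
  t `^ (complex.Re s - 1) * expR (- (a * t)) *
  (v `^ (complex.Re z - 1) * expR (- (t * v))))); last exact/funext.
rewrite RintegralZl//; last exact: integrable_powRMexpNM.
rewrite Rintegral_powRMexpN// /h.
have -> : complex.Re (s - z) - 1 = complex.Re s - 1 + - complex.Re z.
  by case: (s) => ? ?; case: (z) => ? ? /=; rewrite addrAC.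
by rewrite [t `^ (_ + - complex.Re z)]powRD ?(gt_eqF t0) ?implybT//; ring.
Qed.

Let ih : lebesgue_measure.-integrable `]0, +oo[ (EFin \o h).
Proof. by apply: integrable_itv0yZl; exact: integrable_powRMexpNM. Qed.

Let in0y (t : R) : (`]0, +oo[ : set R) t -> 0 < t.
Proof. by rewrite /= in_itv/= andbT. Qed.

Let fint1 v : 0 < v -> cintegral (@lebesgue_measure R) `]0, +oo[ (f v) =
  cpow v (z - 1) * eta_int s (v + a).
Proof.
move=> v0; rewrite /f /eta_int -cintegralZ//.
by apply: cintegrable_eta_kernel => //; rewrite addr_gt0.
Qed.

(** Over v, v^(z - 1) e^(-tv) integrates to Gamma(z) t^(-z), and t^(-z) changes the exponent of the
    kernel from s - 1 to s - z - 1. *)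
Let fint2 t : 0 < t -> cintegral (@lebesgue_measure R) `]0, +oo[ (f ^~ t) =
  Gamma z * eta_kernel (s - z) a t.
Proof.
move=> t0.
rewrite (@eq_cintegral_itv0y _ _ (fun v => eta_kernel s a t *
  (cpow v (z - 1) * (expR (- (t * v)))%:C))); last first.
  move=> v v0; rewrite /f /eta_kernel (addrC v) eta_weightD (mulrC t v) rmorphM/=.
  ring.
rewrite cintegralZ//; last exact: cintegrable_cpowMexpN.
rewrite cintegral_cpowMexpN// mulrCA; congr (_ * _).
by rewrite /eta_kernel mulrAC -cpowD addrAC.
Qed.

Lemma cintegrable_mellin_eta : cintegrable (@lebesgue_measure R) `]0, +oo[
  (fun v => cpow v (z - 1) * eta_int s (v + a)).
Proof.
apply: (eq_cintegrable_itv0y fint1).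
apply: (@cintegrable_cintegral _ _ (measurableTypeR R) (measurableTypeR R) R
  lebesgue_measure lebesgue_measure `]0, +oo[%classic `]0, +oo[%classic
  _ _ f g h) => //.
- by move=> v t /in0y v0 /in0y t0; exact: fg.
- by move=> v /in0y; exact: ig2.
- by move=> t /in0y; exact: ig1.
- by move=> t /in0y t0; rewrite gh.
Qed.

Lemma cintegral_mellin_eta : cintegral (@lebesgue_measure R) `]0, +oo[
  (fun v => cpow v (z - 1) * eta_int s (v + a)) = Gamma z * eta_int (s - z) a.
Proof.
rewrite -(eq_cintegral_itv0y fint1).
rewrite (@cintegral_Fubini _ _ (measurableTypeR R) (measurableTypeR R) R
  lebesgue_measure lebesgue_measure `]0, +oo[%classic `]0, +oo[%classic
  _ _ f g h) //.
- rewrite (eq_cintegral_itv0y fint2) cintegralZ//.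
  exact: cintegrable_eta_kernel.
- by move=> v t /in0y v0 /in0y t0; exact: fg.
- by move=> v /in0y; exact: ig2.
- by move=> t /in0y; exact: ig1.
- by move=> t /in0y t0; rewrite gh.
Qed.

End mellin.

Unset Implicit Arguments.
Set Strict Implicit.

(** The Mellin formula for s = b + 1 and a = w + 1/2, divided by Gamma(b + 1). Integrability is
    asserted along with the value because [cintegral] is total: the equality alone would not say
    that the integral converges. *)
Theorem theorem1 (R : realType) (w : R) (b z : R[i])
    (w_gt0 : 0 < w) (z_gt0 : 0 < complex.Re z)
    (bz_gt0 : 0 < complex.Re (b + 1 - z)) :
  cintegrable (@lebesgue_measure R) `]0, +oo[
    (fun v : R => cpow v (z - 1) * alt_hurwitz_zeta (b + 1) (v + w + 2^-1)) /\
  cintegral (@lebesgue_measure R) `]0, +oo[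
    (fun v : R => cpow v (z - 1) * alt_hurwitz_zeta (b + 1) (v + w + 2^-1)) =
  Gamma z * Gamma (b + 1 - z) / Gamma (b + 1) *
    alt_hurwitz_zeta (b + 1 - z) (w + 2^-1).
Proof.
have a0 : 0 < w + 2^-1 by rewrite addr_gt0// invr_gt0.
have s0 : 0 < complex.Re (b + 1).
  have -> : b + 1 = (b + 1 - z) + z by rewrite subrK.
  move: z_gt0 bz_gt0; case: (b + 1 - z) => x y; case: z => x' y' /= *.
  by rewrite addr_gt0.
have fE v : 0 < v -> (Gamma (b + 1))^-1 *
    (cpow v (z - 1) * eta_int (b + 1) (v + (w + 2^-1))) =
    cpow v (z - 1) * alt_hurwitz_zeta (b + 1) (v + w + 2^-1).
  move=> v0; rewrite -(addrA v) alt_hurwitz_zetaE ?addr_gt0// mulrCA.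
  by congr (_ * _); rewrite mulrC.
have fi := cintegrable_mellin_eta z_gt0 bz_gt0 a0.
split.
  by apply: (eq_cintegrable_itv0y fE); exact: cintegrableZ.
rewrite -(eq_cintegral_itv0y fE) cintegralZ// cintegral_mellin_eta//.
rewrite (alt_hurwitz_zetaE bz_gt0)//.
have Gn := Gamma_neq0 bz_gt0; field.
by rewrite Gn Gamma_neq0.
Qed.
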